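(* Let $a,b,c,d\in[0,1]$ with $a+c=b+d=1$. Let $C_n$ be the cycle graph with $n$ vertices ($n\ge3$), and let ${\bf U}$ be the transition probability matrix of the second type of correlated random walk on $C_n$ with respect to $\begin{bmatrix}a&b\\c&d\end{bmatrix}$. Then ${\bf U}$ has $2n$ eigenvalues (counted with multiplicity) of the form $$\lambda=\frac{\mu\pm\sqrt{\mu^2-4(ad-bc)}}{2},\qquad \mu\in\mathrm{Spec}({\bf W}(C_n)),$$ where $\mu$ runs over the eigenvalues of ${\bf W}(C_n)$ with multiplicity.
   Context: Let $V(C_n)=\{v_1,\ldots,v_n\}$ and $e_j=(v_j,v_{j+1})$ for $1\le j\le n$, subscripts modulo $n$; the arc set is $D(C_n)=\{e_1,\ldots,e_n,e_1^{-1},\ldots,e_n^{-1}\}$, where $(u,v)^{-1}=(v,u)$. For an arc $e=(u,v)$ write $o(e)=u$, $t(e)=v$. The transition probability matrix of the second type of correlated random walk on $C_n$ with respect to $\begin{bmatrix}a&b\\c&d\end{bmatrix}$ is the $2n\times 2n$ matrix ${\bf U}=(U_{ef})_{e,f\in D(C_n)}$ with: $U_{ef}=d$ if $t(f)=o(e)$, $f\ne e^{-1}$ and $f=e_j$ for some $j$; $U_{ef}=b$ if $f=e^{-1}$ and $f=e_j$ for some $j$; $U_{ef}=a$ if $t(f)=o(e)$, $f\ne e^{-1}$ and $f=e_j^{-1}$ for some $j$; $U_{ef}=c$ if $f=e^{-1}$ and $f=e_j^{-1}$ for some $j$; $U_{ef}=0$ otherwise. The $n\times n$ matrix ${\bf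 W}(C_n)=(w_{uv})_{u,v\in V(C_n)}$ has $w_{uv}=w(u,v)$ if $(u,v)\in D(C_n)$ and $0$ otherwise, where $w(e_j)=d$ and $w(e_j^{-1})=a$ for $1\le j\le n$. Spec denotes the multiset of complex eigenvalues; square roots are complex (both signs are taken). *)

(* Defs.v *)
(* The real numbers are a realType R and the complex numbers are R[i]. *)
From HB Require Import structures.
From mathcomp Require Import all_boot all_order all_algebra.
From mathcomp Require Import reals complex.
Set Implicit Arguments.
Unset Strict Implicit.
Unset Printing Implicit Defensive.
Import Order.TTheory GRing.Theory Num.Theory.
Local Open Scope ring_scope.

Section CycleGraph.
Variable n : nat.

(* The vertices v_1, ..., v_n are the elements 0, ..., n - 1 of 'I_n, and
   ordS is the successor modulo n. The definitions below describe the simple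
   cycle C_n when n >= 3; the arcs e_j and e_k^-1 are then all distinct. *)
Definition arc_origin (e : 'I_n * 'I_n) : 'I_n := e.1.
Definition arc_terminus (e : 'I_n * 'I_n) : 'I_n := e.2.
Definition arc_inv (e : 'I_n * 'I_n) : 'I_n * 'I_n := (e.2, e.1).

Definition cycle_arc (j : 'I_n) : 'I_n * 'I_n := (j, ordS j).

Definition forward_arcs : {set 'I_n * 'I_n} :=
  [set cycle_arc j | j : 'I_n].
Definition backward_arcs : {set 'I_n * 'I_n} :=
  [set arc_inv (cycle_arc j) | j : 'I_n].
Definition cycle_arcs : {set 'I_n * 'I_n} := forward_arcs :|: backward_arcs.

Variable R : realType.
Variables a b c d : R.

Definition walk_weight (e f : 'I_n * 'I_n) : R :=
  if [&& arc_terminus f == arc_origin e, f != arc_inv e & f \in forward_arcs]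
  then d
  else if (f == arc_inv e) && (f \in forward_arcs) then b
  else if [&& arc_terminus f == arc_origin e, f != arc_inv e
            & f \in backward_arcs] then a
  else if (f == arc_inv e) && (f \in backward_arcs) then c
  else 0.

(* The rows and columns are indexed by the arcs through the enumeration
   enum_val : 'I_#|cycle_arcs| -> 'I_n * 'I_n of the arc set. *)
Definition walk_matrix : 'M[R]_#|cycle_arcs| :=
  \matrix_(i, j) walk_weight (enum_val i) (enum_val j).

Definition arc_weight (e : 'I_n * 'I_n) : R :=
  if e \in forward_arcs then d else a.

Definition vertex_matrix : 'M[R]_n :=
  \matrix_(u, v) (if (u, v) \in cycle_arcs then arc_weight (u, v) else 0).

End CycleGraph.

(* The complex eigenvalues of a real matrix, listed with algebraic
   multiplicity. The order of the list is arbitrary, so multisets of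
   eigenvalues are compared with perm_eq. *)
Definition Spec (R : realType) (m : nat) (A : 'M[R]_m) : seq R[i] :=
  sval (closed_field_poly_normal (char_poly (map_mx (real_complex R) A))).

Lemma char_poly_Spec (R : realType) (m : nat) (A : 'M[R]_m) :
  char_poly (map_mx (real_complex R) A) = \prod_(x <- Spec A) ('X - x%:P).
Proof.
rewrite /Spec; case: closed_field_poly_normal => s /= {1}->.
by rewrite (monicP (char_poly_monic _)) scale1r.
Qed.

(* Main.v *)
Require Import Defs.
From HB Require Import structures.
From mathcomp Require Import all_boot all_order all_algebra.
From mathcomp Require Import fingroup perm.
From mathcomp Require Import reals complex.
From mathcomp Require Import ring zify.
Set Implicit Arguments.
Unset Strict Implicit.
Unset Printing Implicit Defensive.
Import Order.TTheory GRing.Theory Num.Theory.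
Local Open Scope ring_scope.

(** The characteristic polynomial of the walk factors because the walk has only
two kinds of transitions. List the forward arcs [e_j] first and the backward
arcs [e_j^-1] second, both in the order of [j], and let [Q] be the permutation
matrix of the rotation of the cycle. A step that keeps its direction rotates the
index, while a step that turns back keeps it, so the transition matrix becomes
[block_mx A c%:M b%:M D] with [A = d *: Q^T] and [D = a *: Q]
([walk_matrix_block]), and the vertex matrix is the transpose of [A + D]
([vertex_matrix_perm]).

As [Q] is orthogonal, [A *m D = (a * d)%:M]. The lower blocks of [t - U]
commute, [b] being scalar, and so
[det (t - U) = det ((t - A) (t - D) - b c)
             = det (t ^ 2 - t (A + D) + (a d - b c))],
which only involves [A + D]. If [A + D] has eigenvalues [mu], this determinant is
the product of the [t ^ 2 - t mu + (a d - b c)] ([char_poly_block_scalar]).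
The quadratic formula splits each factor ([quadratic_factor]), and a product of
linear factors determines the multiset of its roots.

The computation takes place at scalars [t] outside a finite set, where the
required divisions are possible; the polynomial identity follows since the field
is infinite ([poly_eq_off_roots]). *)

(** * Determinants and characteristic polynomials *)

(** Both dimensions are forced to agree by the bijection, but [m] and [p] are kept
apart because the cardinal of a set of arcs is not convertible to a sum; after
identifying them, rows and columns undergo the same permutation, whose sign
cancels. *)
Lemma det_mxsub_bij (R : comPzRingType) (m p : nat) (f : 'I_m -> 'I_p)
    (A : 'M[R]_p) :
  bijective f -> \det (mxsub f f A) = \det A.
Proof.
move=> bij_f; have def_p : p = m.
  by have := bij_eq_card bij_f; rewrite !card_ord.
case: m / def_p f bij_f => f /bij_inj inj_f.
have -> : mxsub f f A = row_perm (perm inj_f) (col_perm (perm inj_f) A).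
  by apply/matrixP=> i j; rewrite !mxE !permE.
rewrite row_permE col_permE !det_mulmx !det_perm odd_permV.
by rewrite mulrC -mulrA -signr_addb addbb mulr1.
Qed.

Lemma char_poly_mxsub_bij (R : comNzRingType) (m p : nat) (f : 'I_m -> 'I_p)
    (A : 'M[R]_p) :
  bijective f -> char_poly (mxsub f f A) = char_poly A.
Proof.
move=> bij_f; rewrite /char_poly -(det_mxsub_bij _ bij_f); congr (\det _).
by apply/matrixP=> i j; rewrite !mxE (bij_eq bij_f).
Qed.

Lemma char_poly_tr (R : comNzRingType) (m : nat) (A : 'M[R]_m) :
  char_poly A^T = char_poly A.
Proof.
rewrite /char_poly -[RHS]det_tr; congr (\det _).
by apply/matrixP=> i j; rewrite !mxE eq_sym.
Qed.

Lemma horner_char_poly (R : comNzRingType) (m : nat) (A : 'M[R]_m) (t : R) :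
  (char_poly A).[t] = \det (t%:M - A).
Proof.
rewrite /char_poly -horner_evalE -det_map_mx; congr (\det _).
by apply/matrixP=> i j; rewrite !mxE /= /horner_eval !hornerE hornerMn hornerX.
Qed.

(** Multiplying on the right by [block_mx D 0 (- C) 1%:M], of determinant
[\det D], makes the matrix block upper triangular, since [C] and [D] commute.
The hypothesis on [\det D] allows the factor to be cancelled. *)
Lemma det_block_comm (R : idomainType) (m : nat) (A B C D : 'M[R]_m) :
  C *m D = D *m C -> \det D != 0 ->
  \det (block_mx A B C D) = \det (A *m D - B *m C).
Proof.
move=> commCD nzD; apply: (mulIf nzD).
have -> : \det D = \det (block_mx D 0 (- C) 1%:M).
  by rewrite det_lblock det1 mulr1.
rewrite -det_mulmx mulmx_block !mulmxN !mulmx1 !mulmx0 !add0r commCD subrr.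
by rewrite det_ublock det_lblock det1 mulr1.
Qed.

(** [r * (p - q)] vanishes everywhere, hence at more integers than its degree
permits. *)
Lemma poly_eq_off_roots (F : numDomainType) (p q r : {poly F}) :
  r != 0 -> (forall t, r.[t] != 0 -> p.[t] = q.[t]) -> p = q.
Proof.
move=> nz_r eq_pq; apply/eqP; rewrite -subr_eq0.
suff /eqP : r * (p - q) = 0 by rewrite mulf_eq0 (negbTE nz_r).
pose rs : seq F := [seq i%:R | i <- iota 0 (size (r * (p - q)))].
apply: (@roots_geq_poly_eq0 _ _ rs).
- apply/allP=> t _; rewrite rootM; case: (boolP (root r t)) => //= nr.
  by rewrite /root !hornerE eq_pq ?subrr.
- by rewrite map_inj_uniq ?iota_uniq //; exact/mulrIn/oner_neq0.
- by rewrite size_map size_iota.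
Qed.

(** The homogeneous form of the characteristic polynomial: pulling out [y] leaves
its value at [x / y], multiplied by [y ^+ m]. *)
Lemma det_scalar_sub_scale (F : fieldType) (m : nat) (M : 'M[F]_m) (s : seq F)
    (x y : F) :
  char_poly M = \prod_(mu <- s) ('X - mu%:P) -> y != 0 ->
  \det (x%:M - y *: M) = \prod_(mu <- s) (x - y * mu).
Proof.
move=> def_s nz_y; have sz_s : size s = m.
  by apply/succn_inj; rewrite -(size_char_poly M) def_s size_prod_XsubC.
have -> : x%:M - y *: M = y *: ((x / y)%:M - M).
  by rewrite scalerBr scale_scalar_mx mulrC divfK.
rewrite detZ -horner_char_poly def_s horner_prod -{1}sz_s.
have -> : y ^+ size s = \prod_(mu <- s) y.
  by rewrite big_const_seq count_predT iter_mulr_1.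
rewrite -big_split /=; apply: eq_bigr => mu _.
by rewrite !hornerE mulrBr mulrC divfK.
Qed.

(** At [t], the commuting block formula yields
[\det ((t ^+ 2 + (p - b * c))%:M - t *: (A + D))], because [A *m D] is scalar;
the spectrum of [A + D] then gives its value. *)
Lemma char_poly_block_scalar (F : numFieldType) (m : nat) (A D : 'M[F]_m)
    (b c p : F) (s : seq F) :
  A *m D = p%:M ->
  char_poly (A + D) = \prod_(mu <- s) ('X - mu%:P) ->
  char_poly (block_mx A c%:M b%:M D) =
    \prod_(mu <- s) ('X^2 - mu *: 'X + (p - b * c)%:P).
Proof.
move=> defAD def_s.
apply: (@poly_eq_off_roots _ _ _ ('X * char_poly D)).
  (* The excluded scalars are 0, by which the second determinant is rescaled,
     and the eigenvalues of D, at which the block formula cannot cancel. *)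
  by rewrite mulf_neq0 ?polyX_eq0 // monic_neq0 // char_poly_monic.
move=> t; rewrite hornerM hornerX mulf_eq0 negb_or horner_char_poly.
case/andP=> nz_t nz_D; rewrite horner_char_poly scalar_mx_block opp_block_mx.
rewrite add_block_mx !add0r det_block_comm //; last first.
  by rewrite mulNmx mulmxN scalar_mxC.
have -> : (t%:M - A) *m (t%:M - D) - - c%:M *m - b%:M =
          (t ^+ 2 + (p - b * c))%:M - t *: (A + D).
  rewrite mulNmx mulmxN opprK -scalar_mxM mulmxBl !mulmxBr defAD -scalar_mxM.
  rewrite mul_scalar_mx mul_mx_scalar; apply/matrixP=> i j.
  by rewrite !mxE; case: eqP => _; rewrite ?mulr1n ?mulr0n; ring.
rewrite (det_scalar_sub_scale _ def_s nz_t) horner_prod.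
by apply: eq_bigr => mu _; rewrite !hornerE /=; ring.
Qed.

(** * The cycle graph *)

Section Cycle.
Variable n : nat.

Definition cycle_perm : 'S_n := perm (@ordS_inj n).

Lemma cycle_permE (j : 'I_n) : cycle_perm j = ordS j.
Proof. by rewrite permE. Qed.

(** The order on arcs that exhibits the blocks: forward arcs in the left summand,
backward arcs in the right one. *)
Definition arc_of_ord (k : 'I_(n + n)) : 'I_n * 'I_n :=
  match split k with
  | inl j => cycle_arc j
  | inr j => arc_inv (cycle_arc j)
  end.

Hypothesis n_ge3 : (3 <= n)%N.

(** The reason why the cycle needs three vertices: with one or two of them, going round the cycle in two steps would make a forward arc equal to a
backward arc, and the arcs would no longer number [n + n]. *)
Lemma ordS2_neq (j : 'I_n) : ordS (ordS j) != j.
Proof.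
apply/eqP=> /(congr1 val) /=; case: j => j /= ltj.
have [lt1|ge1] := ltnP j.+1 n.
  rewrite (modn_small lt1); have [lt2|ge2] := ltnP j.+2 n.
    by rewrite modn_small //; lia.
  have -> : j.+2 = n by lia.
  by rewrite modnn; lia.
have -> : j.+1 = n by lia.
by rewrite modnn modn_small; lia.
Qed.

Lemma arc_of_ord_inj : injective arc_of_ord.
Proof.
move=> k l; rewrite /arc_of_ord => eq_kl.
rewrite -[k]splitK -[l]splitK; congr unsplit.
case: (split k) (split l) eq_kl => [i|i] [j|j] [].
- by move=> ->.
- by move=> -> /eqP; rewrite (negbTE (ordS2_neq _)).
- by move=> <- /esym/eqP; rewrite (negbTE (ordS2_neq _)).
- by move=> _ ->.
Qed.

Lemma cycle_arc_inv_neq (i j : 'I_n) : cycle_arc i != arc_inv (cycle_arc j).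
Proof.
by apply/eqP=> -[-> /eqP]; rewrite (negbTE (ordS2_neq _)).
Qed.

Lemma cycle_arc_inj : injective (@cycle_arc n).
Proof. by move=> i j [->]. Qed.

Lemma arc_inv_inj : injective (@arc_inv n).
Proof. by move=> [? ?] [? ?] [-> ->]. Qed.

Lemma cycle_arc_forward j : cycle_arc j \in forward_arcs n.
Proof. exact: imset_f. Qed.

Lemma cycle_arc_backward j : cycle_arc j \in backward_arcs n = false.
Proof.
by apply/imsetP=> -[k _ /eqP]; rewrite (negbTE (cycle_arc_inv_neq _ _)).
Qed.

Lemma arc_inv_forward j : arc_inv (cycle_arc j) \in forward_arcs n = false.
Proof.
by apply/imsetP=> -[k _ /esym/eqP]; rewrite (negbTE (cycle_arc_inv_neq _ _)).
Qed.

Lemma arc_inv_backward j : arc_inv (cycle_arc j) \in backward_arcs n.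
Proof. exact: (imset_f (fun k => arc_inv (cycle_arc k))). Qed.

Lemma cycle_arcs_image : cycle_arcs n = arc_of_ord @: [set: 'I_(n + n)].
Proof.
apply/setP=> e; apply/idP/imsetP.
  rewrite inE => /orP[] /imsetP[j _ ->].
    by exists (lshift n j); rewrite // /arc_of_ord (unsplitK (inl j)).
  by exists (rshift n j); rewrite // /arc_of_ord (unsplitK (inr j)).
case=> k _ ->; rewrite inE /arc_of_ord; case: (split k) => j.
  by rewrite cycle_arc_forward.
by rewrite arc_inv_backward orbT.
Qed.

Lemma card_cycle_arcs : #|cycle_arcs n| = (n + n)%N.
Proof.
rewrite cycle_arcs_image card_imset ?cardsT ?card_ord //.
exact: arc_of_ord_inj.
Qed.

Variables (R : realType) (a b c d : R).

(** The entry at row [e] and column [f] is the probability of passing from [f] to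
[e]. From [e_j] the walk goes on to [e_(j+1)] or turns to [e_j^-1], and from
[e_j^-1] it goes on to [e_(j-1)^-1] or turns to [e_j]; the continuing
steps are the transposed rotation on forward arcs and the rotation on backward
arcs. *)
Lemma walk_matrix_block :
  exists2 f : 'I_(n + n) -> 'I_#|cycle_arcs n|, bijective f &
    mxsub f f (walk_matrix n a b c d) =
    block_mx (d *: (perm_mx cycle_perm)^T) c%:M b%:M (a *: perm_mx cycle_perm).
Proof.
have arcP k : arc_of_ord k \in cycle_arcs n.
  by rewrite cycle_arcs_image imset_f.
have n_gt0 : (0 < n)%N by exact: leq_trans n_ge3.
pose f k := enum_rank_in (arcP (lshift n (Ordinal n_gt0))) (arc_of_ord k).
have fK k : enum_val (f k) = arc_of_ord k by rewrite enum_rankK_in.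
exists f.
  apply: inj_card_bij; last by rewrite !card_ord card_cycle_arcs.
  by move=> k l /(congr1 enum_val); rewrite !fK => /arc_of_ord_inj.
have invK : involutive (@arc_inv n) by case.
have neqFB (i j : 'I_n) : (cycle_arc i == arc_inv (cycle_arc j)) = false.
  exact: negbTE (cycle_arc_inv_neq i j).
have neqBF (i j : 'I_n) : (arc_inv (cycle_arc i) == cycle_arc j) = false.
  by rewrite eq_sym neqFB.
apply/matrixP=> k l; rewrite !mxE !fK /walk_weight /arc_of_ord.
case: (split k) => i; rewrite !mxE; case: (split l) => j; rewrite !mxE ?invK.
(* In the off-diagonal blocks, f ends where e starts exactly when f is the
   inverse of e, so the branches with weights a and d are void there. *)
- rewrite cycle_arc_forward neqFB cycle_arc_backward /= cycle_permE.
  rewrite !andbT !andbF.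
  by case: eqP => _; rewrite ?mulr1 ?mulr0.
- rewrite arc_inv_forward arc_inv_backward !andbF andbT.
  rewrite (inj_eq arc_inv_inj) (inj_eq cycle_arc_inj) /= (eq_sym j).
  by case: eqP.
- rewrite cycle_arc_forward !andbT (inj_eq cycle_arc_inj) cycle_arc_backward.
  rewrite !andbF /= (inj_eq (@ordS_inj n)) (eq_sym j).
  by case: eqP.
- rewrite arc_inv_forward arc_inv_backward neqBF !andbF /= cycle_permE.
  rewrite andbT eq_sym.
  by case: eqP => _; rewrite ?mulr1 ?mulr0.
Qed.

(** No entry receives both weights, because [(u, ordS u)] is never a backward
arc. *)
Lemma vertex_matrix_perm :
  vertex_matrix n a d =
  d *: perm_mx cycle_perm + a *: (perm_mx cycle_perm)^T.
Proof.
apply/matrixP=> u v; rewrite !mxE !cycle_permE /arc_weight inE.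
have -> : ((u, v) \in forward_arcs n) = (ordS u == v).
  by apply/imsetP/eqP => [[j _ [-> ->]] // | <-]; exists u.
have -> : ((u, v) \in backward_arcs n) = (ordS v == u).
  by apply/imsetP/eqP => [[j _ [-> ->]] // | <-]; exists v.
case: (ordS u =P v) => [<-|_] /=.
  by rewrite (negbTE (ordS2_neq u)) mulr1 mulr0 addr0.
by case: eqP => _; rewrite ?mulr1 !mulr0 ?add0r ?addr0.
Qed.

End Cycle.

(** * Eigenvalues *)

Lemma size_Spec (R : realType) (m : nat) (A : 'M[R]_m) : size (Spec A) = m.
Proof.
apply/succn_inj; rewrite -(size_char_poly (map_mx (real_complex R) A)).
by rewrite char_poly_Spec size_prod_XsubC.
Qed.

Lemma quadratic_factor (F : numClosedFieldType) (mu delta : F) :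
  let s := sqrtC (mu ^+ 2 - 4 * delta) in
  'X^2 - mu *: 'X + delta%:P =
  ('X - ((mu + s) / 2)%:P) * ('X - ((mu - s) / 2)%:P).
Proof.
move=> s; set x := (mu + s) / 2; set y := (mu - s) / 2.
have -> : mu = x + y by rewrite /x /y; field.
have -> : delta = x * y.
  have -> : x * y = (mu ^+ 2 - s ^+ 2) / 4 by rewrite /x /y; field.
  by rewrite sqrtCK; field.
by move: x y => x y; rewrite -mul_polyC polyCD polyCM; ring.
Qed.

Theorem corollary6 (R : realType) (n : nat) (a b c d : R)
    (hn : (3 <= n)%N)
    (ha : 0 <= a <= 1) (hb : 0 <= b <= 1) (hc : 0 <= c <= 1) (hd : 0 <= d <= 1)
    (hac : a + c = 1) (hbd : b + d = 1) :
  size (Spec (walk_matrix n a b c d)) = (2 * n)%N /\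
  perm_eq (Spec (walk_matrix n a b c d))
    (flatten
       [seq (let s := sqrtC (mu ^+ 2 - 4 * real_complex R (a * d - b * c)) in
             [:: (mu + s) / 2; (mu - s) / 2])
       | mu <- Spec (vertex_matrix n a d)]).
Proof.
split; first by rewrite size_Spec card_cycle_arcs // mul2n addnn.
pose phi := real_complex R; pose Q : 'M[R]_n := perm_mx (cycle_perm n).
have QtQ : Q^T *m Q = 1%:M by rewrite tr_perm_mx -perm_mxM mulVg perm_mx1.
apply: prod_XsubC_eq; rewrite -char_poly_Spec big_flatten big_map /=.
rewrite -map_char_poly; have [f bij_f def_f] := walk_matrix_block hn a b c d.
rewrite -(char_poly_mxsub_bij _ bij_f) def_f map_char_poly map_block_mx.
rewrite !map_scalar_mx.
rewrite (@char_poly_block_scalar _ _ _ _ _ _ (phi (a * d))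
           (Spec (vertex_matrix n a d))).
- apply: eq_bigr => mu _; rewrite -rmorphM -rmorphB quadratic_factor.
  by rewrite big_cons big_seq1.
- rewrite -map_mxM -scalemxAl -scalemxAr QtQ scalerA scalemx1 map_scalar_mx.
  by rewrite mulrC.
- rewrite -char_poly_Spec -map_mxD -[RHS]char_poly_tr map_trmx.
  by rewrite vertex_matrix_perm // !linearD /= !linearZ /= trmxK.
Qed.
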